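(* Let $f\colon\mathbf{R}^n\to\mathbf{R}$ be a symmetric function and let $F=f\circ\lambda\colon\mathbf{S}^n\to\mathbf{R}$. Let $a\in\mathbf{R}^n$ and suppose that $F$ is $C^2$-smooth around the matrix $A:=\operatorname{Diag}(a)$. For any matrix $B\in\mathbf{S}^n$ define $Z:=\nabla^2F(A)[B]\in\mathbf{S}^n$. Then $$\operatorname{diag}(Z)=\nabla^2 f(a)[\operatorname{diag}(B)],$$ while for indices $i\neq j$ we have $$Z_{ij}=\begin{cases} B_{ij}\left(\dfrac{\nabla f(a)_i-\nabla f(a)_j}{a_i-a_j}\right) & \text{if } a_i\neq a_j,\\[2mm] B_{ij}\big(\nabla^2f(a)_{ii}-\nabla^2f(a)_{ij}\big) & \text{if } a_i=a_j.\end{cases}$$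
   Context: $\mathbf{S}^n$ is the space of real symmetric $n\times n$ matrices with the trace inner product $\langle X,Y\rangle=\operatorname{tr}(XY)$; gradients and Hessians of functions on $\mathbf{S}^n$ are taken with respect to it, so $\nabla F(A)\in\mathbf{S}^n$ and $\nabla^2F(A)\colon\mathbf{S}^n\to\mathbf{S}^n$ is the linear operator given by the derivative of $X\mapsto\nabla F(X)$ at $A$. For a vector $x$, $\operatorname{Diag}(x)$ is the diagonal matrix with $x$ on its diagonal; for a matrix $X$, $\operatorname{diag}(X)$ is the vector of its diagonal entries. $\lambda\colon\mathbf{S}^n\to\mathbf{R}^n$ assigns to $X$ its vector of eigenvalues (with multiplicity) in nonincreasing order. A function $f$ on $\mathbf{R}^n$ is symmetric if $f(\pi x)=f(x)$ for all $x\in\mathbf{R}^n$ and all coordinate permutations $\pi$. $\nabla f(a)_i$ and $\nabla^2 f(a)_{ij}$ denote entries of the gradient vector and Hessian matrix of $f$ at $a$. ''$C^2$-smooth around $A$'' means twice continuously differentiable on a neighborhood of $A$. *)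

(* Defs.v *)
From HB Require Import structures.
From mathcomp Require Import all_boot all_order all_fingroup all_algebra.
From mathcomp Require Import all_classical all_reals all_analysis.

Set Implicit Arguments.
Unset Strict Implicit.
Unset Printing Implicit Defensive.

Import Order.TTheory GRing.Theory Num.Theory.
Import numFieldNormedType.Exports.

Local Open Scope classical_set_scope.
Local Open Scope ring_scope.

Section SymmetricMatrices.
Variables (R : realType) (n : nat).

Definition is_sym : {pred 'M[R]_n} := fun X => X^T == X.

Record symmat := SymMat { symval :> 'M[R]_n ; _ : symval \in is_sym }.

HB.instance Definition _ := [isSub for symval].
HB.instance Definition _ := [Choice of symmat by <:].

Lemma is_sym_submod : submod_closed is_sym.
Proof.
split; first by rewrite unfold_in trmx0.
move=> c X Y; rewrite !unfold_in => /eqP XT /eqP YT.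
by rewrite linearD linearZ/= XT YT.
Qed.

HB.instance Definition _ :=
  GRing.isSubmodClosed.Build R 'M[R]_n is_sym is_sym_submod.
HB.instance Definition _ := [SubChoice_isSubLmodule of symmat by <:].

Definition symnorm (X : symmat) : R := `|symval X|.

Lemma symnormD X Y : symnorm (X + Y) <= symnorm X + symnorm Y.
Proof. exact: ler_normD. Qed.

Lemma symnormZ (c : R) X : symnorm (c *: X) = `|c| * symnorm X.
Proof. exact: normrZ. Qed.

Lemma symnorm0_eq0 X : symnorm X = 0 -> X = 0.
Proof. by move=> /normr0_eq0 X0; apply: val_inj. Qed.

(* The norm inherited from ['M[R]_n]; in finite dimension the choice of norm
   affects neither the topology nor differentiability. *)
HB.instance Definition _ :=
  Lmodule_isNormed.Build R symmat symnormD symnormZ symnorm0_eq0.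

Lemma diag_mx_sym (x : 'rV[R]_n) : diag_mx x \in is_sym.
Proof. by rewrite unfold_in tr_diag_mx. Qed.

Definition sym_diag (x : 'rV[R]_n) : symmat := SymMat (diag_mx_sym x).

Definition trace_ip (X Y : symmat) : R := \tr (symval X *m symval Y).

(* The roots of the characteristic polynomial, with multiplicity, in
   nonincreasing order; they are all real by the spectral theorem, so that the
   default value 0 is never used. *)
Definition eigvals (X : symmat) : 'rV[R]_n :=
  xget 0 [set l : 'rV[R]_n |
    char_poly (symval X) = \prod_(i < n) ('X - (l 0 i)%:P) /\
    (forall i j : 'I_n, (i <= j)%N -> l 0 j <= l 0 i)].

End SymmetricMatrices.

Definition mxdiag_vec (R : realType) (n : nat) (X : 'M[R]_n) : 'rV[R]_n :=
  \row_i X i i.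

Definition dot_ip (R : realType) (n : nat) (x y : 'rV[R]_n) : R :=
  \sum_(i < n) x 0 i * y 0 i.

Definition symmetric_fun (R : realType) (n : nat) (f : 'rV[R]_n -> R) : Prop :=
  forall (x : 'rV[R]_n) (s : 'S_n), f (col_perm s x) = f x.

Section GradientHessian.
Variables (R : realType) (V : normedModType R) (ip : V -> V -> R).

(* The Riesz representative of the differential with respect to the inner
   product [ip] (meaningful where [F] is differentiable). *)
Definition gradient (F : V -> R) (x : V) : V :=
  xget 0 [set g : V | forall v : V, 'd F x v = ip g v].

Definition hessian (F : V -> R) (x : V) : V -> V := 'd (gradient F) x.

Definition twice_differentiable (F : V -> R) (x : V) : Prop :=
  (\forall y \near x, differentiable F y) /\ differentiable (gradient F) x.

(* The last clause is continuity of the Hessian at [x] in operator norm. *)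
Definition C2_around (F : V -> R) (a : V) : Prop :=
  \forall x \near a, twice_differentiable F x /\
    forall e : R, 0 < e -> \forall y \near x,
      forall v : V, `|hessian F y v - hessian F x v| <= e * `|v|.

End GradientHessian.

(* [hessian_mx f a i j] is the [i]-th partial derivative at [a] of the [j]-th
   entry of the gradient of [f]. *)
Definition hessian_mx (R : realType) (n : nat) (f : 'rV[R]_n -> R)
    (a : 'rV[R]_n) : 'M[R]_n :=
  'J (gradient (@dot_ip R n) f) a.

(* Main.v *)
(** Writing [F = f \o eigvals], the function [F] is invariant under orthogonal
    conjugation, so its gradient [G] is equivariant, and so is the Hessian
    [Z = 'd G A] under conjugations fixing [A = Diag a].  Equivariance under the
    diagonal sign matrices, which fix [A], forces [Z X] to couple the [(i, j)]
    entry only to the same entry of [X], and diagonal entries only to diagonal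
    entries; since [F \o Diag = f], the latter are governed by the Hessian of [f].
    When [a_i <> a_j], differentiating [G (U A U^T) = U (G A) U^T] along
    rotations [U] of the [(i, j)] plane gives the off-diagonal coefficient.  When
    [a_i = a_j], all these rotations fix [A]; the one by pi/4 carries
    [E_ij + E_ji] to [E_ii - E_jj], and the one by pi/2 carries [E_ii] to [E_jj]. *)

Require Import Defs.
From HB Require Import structures.
From mathcomp Require Import all_boot all_order all_fingroup all_algebra.
From mathcomp Require Import all_classical all_reals all_analysis.
From mathcomp Require Import ring lra.
Import Order.TTheory GRing.Theory Num.Theory.
Import numFieldNormedType.Exports.

Set Implicit Arguments.
Unset Strict Implicit.
Unset Printing Implicit Defensive.

Local Open Scope classical_set_scope.
Local Open Scope ring_scope.

(** * Uniqueness and locality of differentials, continuity of linear maps on matrices *)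

Lemma is_diff_unique (R : numFieldType) (V W : normedModType R) (g dg dg' : V -> W)
    (x : V) :
  is_diff x g dg -> is_diff x g dg' -> dg = dg'.
Proof. by case=> _ <- [_ <-]. Qed.

(** The first-order expansion at [x] involves only values near [x]. This matters because the
    gradient identities below hold only where the spectral function is differentiable. *)
Lemma near_eq_is_diff (R : realType) (V W : normedModType R) (g h dg : V -> W)
    (x : V) :
  (\forall y \near x, g y = h y) -> is_diff x g dg -> is_diff x h dg.
Proof.
move=> gh [dxg <-].
have hx : h \o shift x = cst (h x) + 'd g x +o_ 0 id.
  apply/eqaddoP => e e0.
  move: (gh); rewrite (near_shift 0) subr0 => gh0.
  have /eqaddoP /(_ e e0) := diff_locally dxg.
  rewrite (nbhs_singleton gh).
  apply: filter_app; near=> y.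
  have : g (y + x) = h (y + x) by near: y.
  by rewrite !fctE /= => ->.
have dh : 'd h x = 'd g x :> (V -> W) by apply: diff_unique => //; exact: diff_continuous.
split=> //; apply/diff_locallyP; rewrite dh; split=> //.
exact: diff_continuous.
Unshelve. all: by end_near. Qed.

(** Each entry is at most the sup norm, so the summed norms of the images of the matrix units bound
    [L]. *)
Lemma matrix_linear_continuous (R : realType) (m n : nat) (W : normedModType R)
    (L : {linear 'M[R]_(m, n) -> W}) : continuous L.
Proof.
apply: bounded_linear_continuous; apply/linear_boundedP.
near=> C => X; rewrite {1}[X]matrix_sum_delta linear_sum.
apply: (le_trans (ler_norm_sum _ _ _)).
apply: (@le_trans _ _ ((\sum_i \sum_j `|L (delta_mx i j)|) * `|X|)).
  rewrite mulr_suml ler_sum// => i _; rewrite linear_sum mulr_suml.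
  apply: (le_trans (ler_norm_sum _ _ _)); apply: ler_sum => j _.
  rewrite linearZ normrZ mulrC ler_wpM2l//.
  rewrite [leRHS](mx_normrE X); apply/bigmax_geP; right.
  by exists (i, j).
by rewrite ler_wpM2r//; near: C; apply: nbhs_pinfty_ge; rewrite num_real.
Unshelve. all: by end_near. Qed.

(** * Symmetric matrices, orthogonal conjugation and the trace form *)

Section SymmetricMatrix.
Context {R : realType} {n : nat}.
Implicit Types (X Y : symmat R n) (M U : 'M[R]_n).

Lemma symval_inj : injective (@symval R n).
Proof. exact: val_inj. Qed.

Lemma symvalP X i j : X i j = X j i.
Proof.
by case: X => M /= /[!unfold_in] /eqP MT; rewrite -[in LHS]MT mxE.
Qed.

Lemma symval_linear : linear (@symval R n : symmat R n -> 'M[R]_n).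
Proof. by []. Qed.
HB.instance Definition _ := GRing.isLinear.Build R (symmat R n) 'M[R]_n _
  (@symval R n) symval_linear.

Lemma symval_continuous : continuous (@symval R n : symmat R n -> 'M[R]_n).
Proof.
apply: bounded_linear_continuous; apply/linear_boundedP.
by near=> C => X; rewrite ler_peMl//; near: C; apply: nbhs_pinfty_ge.
Unshelve. all: by end_near. Qed.

Lemma symm_subproof M : 2^-1 *: (M + M^T) \in @Defs.is_sym R n.
Proof. by rewrite unfold_in linearZ linearD /= trmxK addrC. Qed.

(** The orthogonal projection onto symmetric matrices; it carries facts about full matrices over to
    [symmat]. *)
Definition symm M : symmat R n := SymMat (symm_subproof M).

Lemma symmE M i j : symm M i j = (M i j + M j i) / 2.
Proof. by rewrite !mxE mulrC. Qed.

Lemma symm_is_linear : linear symm.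
Proof.
move=> c M N; apply/symval_inj/matrixP => i j.
by rewrite linearD linearZ /= !mxE; ring.
Qed.
HB.instance Definition _ := GRing.isLinear.Build R 'M[R]_n (symmat R n) _
  symm symm_is_linear.

Lemma symvalK : cancel (@symval R n) symm.
Proof.
by move=> X; apply/symval_inj/matrixP => i j; rewrite symmE (symvalP X j); field.
Qed.

Lemma symmat_sum_delta X : X = \sum_i \sum_j X i j *: symm (delta_mx i j).
Proof.
rewrite -[LHS]symvalK [X in symm X]matrix_sum_delta linear_sum.
by apply: eq_bigr => i _; rewrite linear_sum; apply: eq_bigr => j _; rewrite linearZ.
Qed.

Lemma symmat_linear_continuous (W : normedModType R)
  (L : {linear symmat R n -> W}) : continuous L.
Proof.
have -> : (L : _ -> _) = (L \o symm) \o @symval R n.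
  by apply/funext => X /=; rewrite symvalK.
move=> X; apply: continuous_comp; first exact: symval_continuous.
exact: matrix_linear_continuous.
Qed.

Lemma sym_diag_is_linear : linear (@sym_diag R n).
Proof. by move=> c x y; apply/symval_inj; rewrite linearD linearZ /= linearD linearZ. Qed.
HB.instance Definition _ := GRing.isLinear.Build R 'rV[R]_n (symmat R n) _
  (@sym_diag R n) sym_diag_is_linear.

Lemma sconj_subproof U X : U *m X *m U^T \in @Defs.is_sym R n.
Proof.
rewrite unfold_in !trmx_mul trmxK mulmxA.
by have := valP X; rewrite unfold_in => /eqP /= ->.
Qed.

Definition sconj U X : symmat R n := SymMat (sconj_subproof U X).

Lemma sconj_is_linear U : linear (sconj U).
Proof.
move=> c X Y; apply/symval_inj; rewrite linearD linearZ /=.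
by rewrite mulmxDr mulmxDl -scalemxAr -scalemxAl.
Qed.
HB.instance Definition _ U := GRing.isLinear.Build R (symmat R n) (symmat R n) _
  (sconj U) (sconj_is_linear U).

Definition is_orthomx U := U *m U^T = 1%:M.

Lemma sconjK U : is_orthomx U -> cancel (sconj U^T) (sconj U).
Proof.
move=> UU X; apply/symval_inj => /=.
by rewrite trmxK !mulmxA UU mul1mx -mulmxA UU mulmx1.
Qed.

Lemma is_orthomx_tr U : is_orthomx U -> is_orthomx U^T.
Proof. by rewrite /is_orthomx trmxK => /mulmx1C. Qed.

Lemma trace_ip_sconj U X Y :
  is_orthomx U -> trace_ip (sconj U X) (sconj U Y) = trace_ip X Y.
Proof.
move=> /mulmx1C UU; rewrite /trace_ip /= -!mulmxA.
by rewrite mxtrace_mulC -!mulmxA UU mulmx1 !mulmxA -(mulmxA _ U^T) UU mulmx1.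
Qed.

(** The antisymmetric part of [M] is trace-orthogonal to the symmetric [X]. *)
Lemma trace_ip_symm X M : trace_ip X (symm M) = \tr (X *m M).
Proof.
rewrite /trace_ip /= -scalemxAr linearZ /= mulmxDr linearD /=.
rewrite -[\tr (X *m M^T)]mxtrace_tr trmx_mul trmxK.
have := valP X; rewrite unfold_in => /eqP /= ->.
by rewrite (mxtrace_mulC M); field.
Qed.

Lemma tr_mul_delta M i j : \tr (M *m delta_mx i j) = M j i.
Proof.
rewrite /mxtrace (bigD1 j)//= mxE (bigD1 i)//= mxE !eqxx mulr1.
rewrite !big1 ?addr0// => k; last first.
  by move=> /negPf ki; rewrite mxE ki mulr0.
by move=> /negPf kj; rewrite mxE big1// => l _; rewrite mxE kj andbF mulr0.
Qed.

Lemma trace_ip_diag X (x : 'rV[R]_n) :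
  trace_ip X (sym_diag x) = dot_ip (mxdiag_vec X) x.
Proof. by apply: eq_bigr => i _; rewrite mul_mx_diag !mxE. Qed.

End SymmetricMatrix.

(** * Riesz representation and gradients *)

Section Riesz.
Context {R : realType} {V : normedModType R}.

(** Existence makes the [xget] in [gradient] return a true representative; uniqueness identifies it
    with any [g] satisfying the defining equation. *)
Definition riesz (ip : V -> V -> R) := forall L : {linear V -> R},
  exists2 g, L =1 ip g & forall h, L =1 ip h -> h = g.

Variable ip : V -> V -> R.
Hypothesis ip_riesz : riesz ip.

Lemma gradientP (F : V -> R) x v : 'd F x v = ip (gradient ip F x) v.
Proof.
have [g gP _] := ip_riesz ('d F x).
exact: (xgetPex 0 (ex_intro [set g | forall v, 'd F x v = ip g v] g gP)).
Qed.

Lemma gradient_unique (F : V -> R) x g :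
  (forall v, 'd F x v = ip g v) -> gradient ip F x = g.
Proof.
move=> gP; have [h _ hu] := ip_riesz ('d F x).
by rewrite (hu g gP); apply: hu => v; exact: gradientP.
Qed.

End Riesz.

Lemma dot_riesz (R : realType) (n : nat) : riesz (@dot_ip R n).
Proof.
move=> L; exists (\row_i L (delta_mx 0 i)) => [x|g gP].
  rewrite {1}[x]row_sum_delta linear_sum; apply: eq_bigr => i _.
  by rewrite linearZ mxE /= mulrC.
apply/rowP => i; rewrite mxE gP /dot_ip (bigD1 i)//= mxE !eqxx mulr1.
by rewrite big1 ?addr0// => j /negPf ji; rewrite mxE ji andbF mulr0.
Qed.

(** The entries of the representative are the values of [L] on symmetrized matrix units; testing
    against these units recovers every entry, hence uniqueness. *)
Lemma trace_riesz (R : realType) (n : nat) : riesz (@trace_ip R n).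
Proof.
move=> L; exists (symm (\matrix_(i, j) L (symm (delta_mx i j)))) => [X|G GP].
  rewrite {1}[X]symmat_sum_delta linear_sum /trace_ip mxtrace_mulC.
  rewrite -/(trace_ip _ _) trace_ip_symm; apply: eq_bigr => i _.
  rewrite linear_sum mxE; apply: eq_bigr => j _.
  rewrite linearZ mxE /= symvalP; congr (_ * L _).
  (* The trace pairs transposed positions, but [delta_mx i j] and [delta_mx j i] have the same
     symmetrization. *)
  apply/symval_inj/matrixP => p q; rewrite !symmE !mxE.
  by rewrite addrC andbC [(q == j) && _]andbC.
apply/symval_inj/matrixP => i j; rewrite symmE !mxE !GP !trace_ip_symm !tr_mul_delta.
by rewrite (symvalP G j); field.
Qed.

(** * Spectral functions: invariance, gradient and Hessian *)

Section SpectralFunction.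
Context {R : realType} {n : nat}.
Implicit Types (X Y : symmat R n) (U : 'M[R]_n) (x : 'rV[R]_n).

(** [eigvals] sees only the characteristic polynomial, and [U (t - X) U^T] has the determinant of
    [t - X] because [U U^T = 1]. *)
Lemma eigvals_sconj U X : is_orthomx U -> eigvals (sconj U X) = eigvals X.
Proof.
move=> UU; rewrite /eigvals /=; suff -> : char_poly (U *m X *m U^T) = char_poly X by [].
rewrite /char_poly; have -> : char_poly_mx (U *m X *m U^T) =
    map_mx polyC U *m char_poly_mx X *m map_mx polyC U^T.
  rewrite /char_poly_mx mulmxBr mulmxBl !map_mxM /= mul_mx_scalar.
  by rewrite -scalemxAl -(map_mxM _ U U^T) UU map_mx1 scalemx1.
by rewrite !det_mulmx mulrAC -det_mulmx -(map_mxM _ U U^T) UU map_mx1 det1 mul1r.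
Qed.

Lemma perm_of_prod_XsubC (x y : 'rV[R]_n) :
  \prod_(i < n) ('X - (x 0 i)%:P) = \prod_(i < n) ('X - (y 0 i)%:P) ->
  exists s : 'S_n, x = col_perm s y.
Proof.
move=> xy.
have /tuple_permP[s xs] :
    perm_eq [seq x 0 i | i <- enum 'I_n] [tuple y 0 i | i < n].
  by apply: prod_XsubC_eq; rewrite !big_image.
exists s; apply/rowP => i.
have := congr1 (nth 0 ^~ i) xs.
rewrite (nth_map i) ?size_enum_ord// nth_ord_enum => ->.
by rewrite -tnth_nth !tnth_mktuple mxE.
Qed.

(** A diagonal matrix has its own entries as eigenvalues up to order, and [f] ignores the order. *)
Lemma spectral_fun_diag (f : 'rV[R]_n -> R) x :
  symmetric_fun f -> f (eigvals (sym_diag x)) = f x.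
Proof.
move=> fsym.
have char_diag : char_poly (sym_diag x) = \prod_(i < n) ('X - (x 0 i)%:P).
  rewrite char_poly_trig ?diag_mx_is_trig//.
  by apply: eq_bigr => i _; rewrite mxE eqxx.
rewrite {1}/eigvals; case: xgetP => [l _ [charl _]|no_l].
  have [s ->] : exists s : 'S_n, l = col_perm s x.
    by apply: perm_of_prod_XsubC; rewrite -charl.
  exact: fsym.
(* The default branch of [xget] is contradictory: the entries of [x] in nonincreasing order are an
   admissible choice. *)
pose t := sort >=%O [seq x 0 i | i <- enum 'I_n].
have t_size : size t = n by rewrite size_sort size_map size_enum_ord.
have := no_l (\row_i t`_i); case; split=> [|i j ij].
  rewrite char_diag; transitivity (\prod_(c <- t) ('X - c%:P)).
    rewrite (perm_big [seq x 0 i | i <- enum 'I_n]) ?big_image//.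
    by rewrite perm_sort.
  rewrite (big_nth 0) t_size big_mkord.
  by apply: eq_bigr => i _; rewrite mxE.
rewrite !mxE.
apply: (@sorted_leq_nth _ (>=%O) _ _ 0 t) => //; rewrite ?inE ?t_size//.
- by move=> a b c ba ab; apply: le_trans ba.
- by move=> a; exact: lexx.
- by apply: sort_sorted => a b; exact: le_total.
Qed.

Lemma is_diff_symmat (W : normedModType R) (L : {linear symmat R n -> W}) X :
  is_diff X L L.
Proof.
have Lc := @symmat_linear_continuous _ _ _ L.
by split; [exact: linear_differentiable|exact: diff_lin].
Qed.

Lemma is_diff_sym_diag x : is_diff x (@sym_diag R n) (@sym_diag R n).
Proof.
have c := @matrix_linear_continuous _ _ _ _ (@sym_diag R n).
by split; [exact: linear_differentiable|exact: diff_lin].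
Qed.

Lemma mxdiag_vec_is_linear : linear (fun X : symmat R n => mxdiag_vec X).
Proof. by move=> c X Y; apply/rowP => i; rewrite linearD linearZ !mxE. Qed.

Section Gradient.
Variables (f : 'rV[R]_n -> R) (fsym : symmetric_fun f).
Let F := f \o @eigvals R n.
Let G := gradient (@trace_ip R n) F.

(** Differentiate the invariance [F \o sconj U^T = F] at [sconj U X], then move [sconj U^T] across
    the trace form, where its adjoint is [sconj U]. *)
Lemma gradient_sconj U X : is_orthomx U -> differentiable F X ->
  G (sconj U X) = sconj U (G X).
Proof.
move=> UU dF; apply: (gradient_unique (@trace_riesz R n)) => W.
have FU V : is_orthomx V -> F \o sconj V = F.
  by move=> VV; apply/funext => Y /=; rewrite /F /= eigvals_sconj.
have UTU := is_orthomx_tr UU.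
have dFU : is_diff (sconj U X) (F \o sconj U^T) ('d F X \o sconj U^T).
  have := is_diff_symmat (sconj U^T) (sconj U X) => ?.
  by apply: is_diff_comp; rewrite -[U in sconj U X]trmxK sconjK.
move: dFU; rewrite FU// => dFU; rewrite diff_val /=.
rewrite (gradientP (@trace_riesz R n)) -/F -/G.
by rewrite -(trace_ip_sconj _ _ UU) sconjK.
Qed.

(** [G \o sconj U] and [sconj U \o G] agree near [A], and [sconj U] fixes [A], so the chain rule at
    [A] computes the same differential twice. *)
Lemma hessian_sconj (A : symmat R n) U X : is_orthomx U -> sconj U A = A ->
  (\forall Y \near A, differentiable F Y) -> differentiable G A ->
  'd G A (sconj U X) = sconj U ('d G A X).
Proof.
move=> UU UA dF dG.
have dU Y := is_diff_symmat (sconj U) Y.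
have d1 : is_diff A (G \o sconj U) ('d G A \o sconj U).
  by apply: is_diff_comp; rewrite UA; exact: differentiableP.
have d2 : is_diff A (sconj U \o G) (sconj U \o 'd G A).
  by apply: is_diff_comp; exact: differentiableP.
have d3 : is_diff A (sconj U \o G) ('d G A \o sconj U).
  apply: near_eq_is_diff d1; apply: filterS dF => Y dF.
  exact: gradient_sconj.
exact: (congr1 (@^~ X) (is_diff_unique d3 d2)).
Qed.

Lemma is_diff_spectral_diag x : differentiable F (sym_diag x) ->
  is_diff x f ('d F (sym_diag x) \o @sym_diag R n).
Proof.
move=> dF; have <- : F \o @sym_diag R n = f.
  by apply/funext => y; exact: spectral_fun_diag.
have := is_diff_sym_diag x => ?.
apply: is_diff_comp; exact: differentiableP.
Qed.

(** Chain rule for [f = F \o sym_diag]: the adjoint of [sym_diag] for the two inner products is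
    [mxdiag_vec]. *)
Lemma gradient_spectral_diag x : differentiable F (sym_diag x) ->
  gradient (@dot_ip R n) f x = mxdiag_vec (G (sym_diag x)).
Proof.
move=> dF; apply: (gradient_unique (@dot_riesz R n)) => v.
have := is_diff_spectral_diag dF => ?.
by rewrite diff_val /= (gradientP (@trace_riesz R n)) trace_ip_diag.
Qed.

(** The previous gradient formula holds on a whole neighborhood of [x], so it can be differentiated
    once more through two linear maps. *)
Lemma is_diff_gradient_spectral_diag (x : 'rV[R]_n) :
  (\forall Y \near sym_diag x, differentiable F Y) ->
  differentiable G (sym_diag x) ->
  (\forall y \near x, differentiable f y) /\
  is_diff x (gradient (@dot_ip R n) f)
    (fun v => mxdiag_vec ('d G (sym_diag x) (sym_diag v))).
Proof.
move=> dF dG.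
have dFx : \forall y \near x, differentiable F (sym_diag y).
  have cD := matrix_linear_continuous (L := @sym_diag R n) (x := x).
  exact: (cD _ dF).
split; first by apply: filterS dFx => y /is_diff_spectral_diag[].
pose mD := GRing.isLinear.Build _ _ _ _ _ mxdiag_vec_is_linear.
pose D : {linear symmat R n -> 'rV[R]_n} :=
  HB.pack (fun X : symmat R n => mxdiag_vec X) mD.
have dGx : is_diff x (D \o (G \o @sym_diag R n))
    (D \o ('d G (sym_diag x) \o @sym_diag R n)).
  have := is_diff_sym_diag x => ?.
  have := is_diff_symmat D (G (sym_diag x)) => ?.
  apply: is_diff_comp; apply: is_diff_comp; exact: differentiableP.
apply: near_eq_is_diff dGx; apply: filterS dFx => y dF'.
by rewrite gradient_spectral_diag.
Qed.

End Gradient.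
End SpectralFunction.

(** * Conjugation by sign matrices and plane rotations *)

Section SignsAndRotations.
Context {R : realType} {n : nat}.
Implicit Types (X Y : symmat R n) (x : 'rV[R]_n) (i j k p q : 'I_n) (c s : R).

(** The reflection flipping coordinate [k]: conjugation negates row and column [k] except the entry
    [(k, k)]. *)
Definition signmx k : 'M[R]_n := diag_mx (\row_i (-1) ^+ (i == k)).

Lemma sconj_signmxE k X p q :
  sconj (signmx k) X p q = (-1) ^+ ((p == k) (+) (q == k)) * X p q.
Proof.
rewrite /= tr_diag_mx mul_diag_mx mul_mx_diag !mxE mulrAC.
by rewrite -signr_addb.
Qed.

Lemma signmx_ortho k : is_orthomx (signmx k).
Proof.
rewrite /is_orthomx tr_diag_mx mulmx_diag; apply/matrixP => p q.
by rewrite !mxE -expr2 sqrr_sign.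
Qed.

Lemma sconj_signmx_diag k x : sconj (signmx k) (sym_diag x) = sym_diag x.
Proof.
apply/symval_inj/matrixP => p q; rewrite sconj_signmxE /= !mxE.
by have [->|_] := eqVneq p q; rewrite ?addbb ?mul1r// mulr0n mulr0.
Qed.

(** The Givens rotation in the [(i, j)] plane; taking cosine and sine as parameters allows both
    algebraic values and functions of an angle. *)
Definition rotmx i j c s : 'M[R]_n := \matrix_(p, q)
  if p == i then c * (q == i)%:R + s * (q == j)%:R
  else if p == j then - s * (q == i)%:R + c * (q == j)%:R
  else (p == q)%:R.

Lemma sum_delta_mul k (u : 'I_n -> R) : \sum_l (l == k)%:R * u l = u k.
Proof.
rewrite (bigD1 k)//= eqxx mul1r big1 ?addr0// => l /negPf ->.
by rewrite mul0r.
Qed.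

Lemma mul_rotmxE m i j c s (M : 'M[R]_(n, m)) p (q : 'I_m) : (rotmx i j c s *m M) p q =
  if p == i then c * M i q + s * M j q
  else if p == j then - s * M i q + c * M j q else M p q.
Proof.
rewrite mxE; under eq_bigr do rewrite mxE.
case: ifP => _; [|case: ifP => _].
- under eq_bigr do rewrite mulrDl -!mulrA.
  by rewrite big_split -!mulr_sumr /= !sum_delta_mul.
- under eq_bigr do rewrite mulrDl -!mulrA.
  by rewrite big_split -!mulr_sumr /= !sum_delta_mul.
- by under eq_bigr do rewrite eq_sym; rewrite sum_delta_mul.
Qed.

Lemma mul_rotmx_trE m i j c s (M : 'M[R]_(m, n)) (p : 'I_m) q :
  (M *m (rotmx i j c s)^T) p q =
  if q == i then c * M p i + s * M p j
  else if q == j then - s * M p i + c * M p j else M p q.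
Proof.
by rewrite -[M]trmxK -trmx_mul mxE mul_rotmxE !mxE.
Qed.

Lemma rotmx_ortho i j c s : i != j -> c ^+ 2 + s ^+ 2 = 1 ->
  is_orthomx (rotmx i j c s).
Proof.
move=> ij cs; apply/matrixP => p q; rewrite mul_rotmxE !mxE.
have ji : (j == i) = false by rewrite eq_sym (negPf ij).
have [?|pi] := eqVneq p i; [subst p|]; rewrite ?eqxx ?ji ?(negPf ij).
  have [?|qi] := eqVneq q i; [subst q|]; rewrite ?eqxx ?ji ?(negPf ij) /=.
    by rewrite -[RHS]cs; ring.
  have [?|qj] := eqVneq q j; [subst q|]; rewrite ?eqxx ?ji ?(negPf ij) /=; first by ring.
  by rewrite ?(negPf qi) ?(negPf qj); ring.
have [?|pj] := eqVneq p j; [subst p|]; rewrite ?eqxx ?ji ?(negPf ij).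
  have [?|qi] := eqVneq q i; [subst q|]; rewrite ?eqxx ?ji ?(negPf ij) /=; first by ring.
  have [?|qj] := eqVneq q j; [subst q|]; rewrite ?eqxx ?ji ?(negPf ij) /=.
    by rewrite -[RHS]cs; ring.
  by rewrite ?(negPf qi) ?(negPf qj); ring.
have [?|qi] := eqVneq q i; first by subst q;
  rewrite ?eqxx ?ji ?(negPf ij) ?(negPf pi) ?(negPf pj) /= ?mulr0n; ring.
have [?|qj] := eqVneq q j; first by subst q;
  rewrite ?eqxx ?ji ?(negPf ij) ?(negPf pi) ?(negPf pj) /= ?mulr0n; ring.
by rewrite eq_sym.
Qed.

(** The sum is already symmetric, so [symm] supplies membership without introducing a factor of one
    half. *)
Definition sym_delta i j : symmat R n := symm (delta_mx i j + delta_mx j i).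

Lemma sym_deltaE i j p q : sym_delta i j p q =
  ((p == i) && (q == j))%:R + ((p == j) && (q == i))%:R.
Proof.
rewrite symmE !mxE [(q == i) && _]andbC [(q == j) && _]andbC; by field.
Qed.

Definition diag_delta i j : symmat R n :=
  sym_diag (delta_mx 0 i - delta_mx 0 j).

Lemma diag_deltaE i j p q :
  diag_delta i j p q = ((p == i)%:R - (p == j)%:R) *+ (p == q).
Proof. by rewrite !mxE eqxx. Qed.

(** The displacement is sorted by order in the angle: second order on the diagonal, first order off
    it. Both parts vanish when the two entries of [x] agree. *)
Lemma sconj_rotmx_diag i j c s x : i != j -> c ^+ 2 + s ^+ 2 = 1 ->
  sconj (rotmx i j c s) (sym_diag x) = sym_diag x +
    ((x 0 j - x 0 i) * s ^+ 2) *: diag_delta i j +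
    ((x 0 j - x 0 i) * (s * c)) *: sym_delta i j.
Proof.
move=> ij cs; apply/symval_inj/matrixP => p q.
rewrite mul_rotmx_trE !mul_rotmxE !mxE !eqxx /=.
have ji : (j == i) = false by rewrite eq_sym (negPf ij).
have c2 : c ^+ 2 = 1 - s ^+ 2 by rewrite -cs addrK.
have [?|pi] := eqVneq p i; [subst p|]; rewrite ?eqxx ?ji ?(negPf ij).
  have [?|qi] := eqVneq q i; [subst q|]; rewrite ?eqxx ?ji ?(negPf ij) /= ?mulr1n ?mulr0n.
    transitivity (c ^+ 2 * x 0 i + s ^+ 2 * x 0 j); first by ring.
    by rewrite c2; field.
  have [?|qj] := eqVneq q j; [subst q|]; rewrite ?eqxx ?ji ?(negPf ij) /= ?mulr1n ?mulr0n.
    by field.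
  rewrite ?[_ == q]eq_sym ?(negPf qi) ?(negPf qj) ?mulr0n; ring.
have [?|pj] := eqVneq p j; [subst p|]; rewrite ?eqxx ?ji ?(negPf ij).
  have [?|qi] := eqVneq q i; [subst q|]; rewrite ?eqxx ?ji ?(negPf ij) /= ?mulr1n ?mulr0n.
    by field.
  have [?|qj] := eqVneq q j; [subst q|]; rewrite ?eqxx ?ji ?(negPf ij) /= ?mulr1n ?mulr0n.
    transitivity (s ^+ 2 * x 0 i + c ^+ 2 * x 0 j); first by ring.
    by rewrite c2; field.
  rewrite ?[_ == q]eq_sym ?(negPf qi) ?(negPf qj) ?mulr0n; ring.
have [?|qi] := eqVneq q i; first by subst q;
  rewrite ?eqxx ?ji ?(negPf ij) ?(negPf pi) ?(negPf pj) /= ?mulr0n; ring.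
have [?|qj] := eqVneq q j; first by subst q;
  rewrite ?eqxx ?ji ?(negPf ij) ?(negPf pi) ?(negPf pj) /= ?mulr0n; ring.
by rewrite /=; ring.
Qed.

Lemma sconj_rotmxE X i j c s : i != j ->
  (sconj (rotmx i j c s) X i j = (c ^+ 2 - s ^+ 2) * X i j + s * c * (X j j - X i i)) *
  (sconj (rotmx i j c s) X i i = c ^+ 2 * X i i + s ^+ 2 * X j j + 2 * s * c * X i j) *
  (sconj (rotmx i j c s) X j j = s ^+ 2 * X i i + c ^+ 2 * X j j - 2 * s * c * X i j).
Proof.
move=> ij; have ji : (j == i) = false by rewrite eq_sym (negPf ij).
rewrite /= !mul_rotmx_trE !mul_rotmxE eqxx ji eqxx (symvalP X j i).
by split; [split|]; ring.
Qed.

End SignsAndRotations.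

(** * Linear operators commuting with the conjugations that fix a diagonal matrix *)

Section EquivariantOperator.
Context {R : realType} {n : nat} {a : 'rV[R]_n}.
Variable Z : {linear symmat R n -> symmat R n}.
Hypothesis Z_sconj : forall U X, is_orthomx U ->
  sconj U (sym_diag a) = sym_diag a -> Z (sconj U X) = sconj U (Z X).
Implicit Types (X B : symmat R n) (i j k p q : 'I_n).

Lemma symmatDE X B p q : (X + B) p q = X p q + B p q.
Proof. by rewrite /= mxE. Qed.

Lemma symmatBE X B p q : (X - B) p q = X p q - B p q.
Proof. by rewrite /= !mxE. Qed.

Lemma symmatZE (c : R) X p q : (c *: X) p q = c * X p q.
Proof. by rewrite /= mxE. Qed.

(* Conjugation by a sign matrix multiplies the [(p, q)] and [(i, j)] entries by
   opposite signs. *)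
Lemma equivariant_delta_eq0 k p q i j :
  (p == k) (+) (q == k) != (i == k) (+) (j == k) ->
  Z (symm (delta_mx p q)) i j = 0.
Proof.
move=> pqij; set X := symm _.
have sX : sconj (signmx k) X = (-1) ^+ ((p == k) (+) (q == k)) *: X.
  apply/symval_inj/matrixP => r s; rewrite sconj_signmxE symmatZE.
  rewrite symmE !mxE.
  have [/andP[/eqP-> /eqP->]//|rspq] := boolP ((r == p) && (s == q)).
  have [/andP[/eqP-> /eqP->]|rsqp] := boolP ((s == p) && (r == q)).
    by rewrite addbC.
  by rewrite addr0 mul0r !mulr0.
have := Z_sconj X (signmx_ortho k) (sconj_signmx_diag k a).
rewrite sX linearZ => /(congr1 (fun Y : symmat R n => Y i j)).
rewrite sconj_signmxE symmatZE; move: pqij.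
by case: (_ (+) _); case: (_ (+) _) => //= _; rewrite ?expr0 ?expr1; lra.
Qed.

(** By linearity over symmetrized units, it suffices that some sign matrix separates each position
    in the support of [X] from [(i, j)]. *)
Lemma equivariant_eq0 X i j :
  (forall p q, X p q != 0 ->
    exists k, (p == k) (+) (q == k) != (i == k) (+) (j == k)) ->
  Z X i j = 0.
Proof.
move=> Xk; rewrite [X]symmat_sum_delta linear_sum /= linear_sum summxE big1// => p _.
rewrite linear_sum /= linear_sum summxE big1// => q _.
rewrite linearZ symmatZE; have [->|/Xk[k /equivariant_delta_eq0 ->]] := eqVneq (X p q) 0.
  by rewrite mul0r.
by rewrite mulr0.
Qed.

(** The difference of the arguments lives off the diagonal; flipping coordinate [p] negates an entry
    [(p, q)] there but preserves [(i, i)]. *)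
Lemma equivariant_diag_entry B i :
  Z B i i = Z (sym_diag (mxdiag_vec B)) i i.
Proof.
apply/eqP; rewrite -subr_eq0 -symmatBE -linearB; apply/eqP.
apply: equivariant_eq0 => p q; rewrite symmatBE /= !mxE.
have [->|pq _] := eqVneq p q; first by rewrite mulr1n subrr eqxx.
by exists p; rewrite eqxx [q == p]eq_sym (negPf pq) addbb.
Qed.

(** Subtracting [B i j *: sym_delta i j] clears positions [(i, j)] and [(j, i)]; flipping [i] or [j]
    separates every other position from them. *)
Lemma equivariant_offdiag_entry B i j : i != j ->
  Z B i j = B i j * Z (sym_delta i j) i j.
Proof.
move=> ij; apply/eqP; rewrite -subr_eq0 -symmatZE -linearZ -symmatBE -linearB.
have ji : (j == i) = false by rewrite eq_sym (negPf ij).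
apply/eqP/equivariant_eq0 => p q; rewrite symmatBE symmatZE sym_deltaE => pq0.
have [?|pi] := eqVneq p i.
  subst p; have [?|qi] := eqVneq q i.
    by subst q; exists i; rewrite eqxx ji.
  have [?|qj] := eqVneq q j.
    by subst q; move: pq0; rewrite !eqxx ji (negPf ij) /= addr0 mulr1 subrr eqxx.
  by exists j; rewrite (negPf qj) (negPf ij) eqxx.
have [?|qi] := eqVneq q i; last by exists i; rewrite (negPf pi) (negPf qi) eqxx ji.
subst q; have [?|pj] := eqVneq p j.
  subst p; move: pq0; rewrite !eqxx ji (negPf ij) /= add0r mulr1.
  by rewrite (symvalP B j) subrr eqxx.
by exists j; rewrite (negPf pj) (negPf ij) eqxx.
Qed.

Lemma sconj_rotmx_fix i j c s : i != j -> c ^+ 2 + s ^+ 2 = 1 ->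
  a 0 i = a 0 j -> sconj (rotmx i j c s) (sym_diag a) = sym_diag a.
Proof.
by move=> ij cs aij; rewrite sconj_rotmx_diag// aij subrr !mul0r !scale0r !addr0.
Qed.

Lemma equivariant_sym_delta i j : i != j -> a 0 i = a 0 j ->
  Z (sym_delta i j) i j =
  Z (sym_diag (delta_mx 0 i)) i i - Z (sym_diag (delta_mx 0 i)) j j.
Proof.
move=> ij aij; have ji : (j == i) = false by rewrite eq_sym (negPf ij).
(* The common value of cosine and sine at pi/4. *)
pose r : R := Num.sqrt 2^-1.
have r2 : r ^+ 2 = 2^-1 by rewrite sqr_sqrtr// invr_ge0.
have rr : r ^+ 2 + r ^+ 2 = 1 by rewrite r2; field.
have rot45 : sconj (rotmx i j r r) (sym_delta i j) = diag_delta i j.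
  apply/symval_inj/matrixP => p q.
  rewrite mul_rotmx_trE !mul_rotmxE !sym_deltaE diag_deltaE.
  have [?|pi] := eqVneq p i; [subst p|]; rewrite ?eqxx ?ji ?(negPf ij).
    have [?|qi] := eqVneq q i; [subst q|];
      rewrite ?eqxx ?ji ?(negPf ij) /= ?mulr0n ?mulr1n.
      by transitivity (r ^+ 2 + r ^+ 2); [ring|rewrite rr; ring].
    have [?|qj] := eqVneq q j; [subst q|];
      rewrite ?eqxx ?ji ?(negPf ij) /= ?mulr0n ?mulr1n.
      by ring.
    by rewrite ?mulr0n; ring.
  have [?|pj] := eqVneq p j; [subst p|]; rewrite ?eqxx ?ji ?(negPf ij).
    have [?|qi] := eqVneq q i; [subst q|];
      rewrite ?eqxx ?ji ?(negPf ij) /= ?mulr0n ?mulr1n.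
      by ring.
    have [?|qj] := eqVneq q j; [subst q|];
      rewrite ?eqxx ?ji ?(negPf ij) /= ?mulr0n ?mulr1n.
      by transitivity (- (r ^+ 2 + r ^+ 2)); [ring|rewrite rr; ring].
    by rewrite ?mulr0n; ring.
  by case: ifP => _; [|case: ifP => _]; rewrite /= subrr mul0rn; ring.
have rot90 : sconj (rotmx i j 0 1) (sym_diag (delta_mx 0 i)) =
    sym_diag (delta_mx 0 j) :> symmat R n.
  rewrite sconj_rotmx_diag// ?expr0n ?expr1n ?add0r// !mxE !eqxx ji.
  rewrite mulr0 mulr0 scale0r addr0 sub0r mulr1 scaleN1r.
  by rewrite /diag_delta linearB /= opprB addrC subrK.
(* The [(i, i)] entry of the rotated image is a combination of two diagonal entries, which vanish
   since [sym_delta i j] has zero diagonal, and [2 r^2 = 1] times the [(i, j)] entry. *)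
have Zdelta : Z (diag_delta i j) i i = Z (sym_delta i j) i j.
  rewrite -rot45 Z_sconj//; [|exact: rotmx_ortho|exact: sconj_rotmx_fix].
  rewrite sconj_rotmxE// r2.
  have Zdiag0 k : Z (sym_delta i j) k k = 0.
    rewrite equivariant_diag_entry.
    have -> : mxdiag_vec (sym_delta i j) = 0 :> 'rV[R]_n.
      apply/rowP => l; rewrite mxE sym_deltaE mxE.
      by have [->|] := eqVneq l i; rewrite ?(negPf ij) ?andbF addr0.
    by rewrite !linear0 /= mxE.
  by rewrite !Zdiag0 !mulr0 !add0r -(mulrA 2) -expr2 r2 divff ?mul1r.
rewrite -Zdelta /diag_delta !linearB symmatBE; congr (_ - _).
(* The quarter turn exchanges the diagonal entries at [i] and [j] of the image. *)
rewrite /= -rot90 Z_sconj; [|apply: rotmx_ortho|apply: sconj_rotmx_fix] => //;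
  rewrite ?expr0n ?expr1n ?add0r//.
by rewrite sconj_rotmxE//; ring.
Qed.

End EquivariantOperator.

(** * Differentiation along a curve of rotations *)

Lemma is_derive1_is_diff (R : realType) (V : normedModType R) (u : R -> V)
    (t : R) (v : V) :
  is_derive t 1 u v -> is_diff t u ( *:%R^~ v).
Proof.
move=> [du uv]; split; first exact/derivable1_diffP.
by rewrite deriv1E// derive1E uv.
Qed.

(* Differentiate [G (sconj U A) = sconj U (G A)] along the rotations [U] in the
   plane [(i, j)]. *)
Lemma diff_rotation_equivariant (R : realType) (n : nat)
    (G : symmat R n -> symmat R n) (a : 'rV[R]_n) (i j : 'I_n) : i != j ->
  differentiable G (sym_diag a) -> G (sym_diag a) i j = 0 ->
  (forall U, is_orthomx U ->
    G (sconj U (sym_diag a)) = sconj U (G (sym_diag a))) ->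
  (a 0 j - a 0 i) * 'd G (sym_diag a) (sym_delta i j) i j =
  G (sym_diag a) j j - G (sym_diag a) i i.
Proof.
move=> ij dG Gij GU; set A := sym_diag a in dG Gij GU *.
pose k := a 0 j - a 0 i; pose l := G A j j - G A i i.
have dsincos m : is_derive (0 : R) 1 (m *: (@sin R * @cos R)) m.
  by apply: is_derive_eq; rewrite sin0 cos0 scale0r add0r scale1r; exact: mulr1.
have dsin2 : is_derive (0 : R) 1 (k *: (@sin R * @sin R)) 0.
  by apply: is_derive_eq; rewrite sin0 !scale0r addr0 scaler0.
(* The orbit of [A] under rotation by angle [t], expanded by [sconj_rotmx_diag] so that its velocity
   at 0 is visibly [k *: sym_delta i j]. *)
pose M t : symmat R n := A + (k *: (@sin R * @sin R)) t *: diag_delta i j +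
  (k *: (@sin R * @cos R)) t *: sym_delta i j.
have dM : is_diff (0 : R) M (fun h => h *: (k *: sym_delta i j)).
  have d1 : is_diff (0 : R) (fun t => (k *: (@sin R * @sin R)) t *: diag_delta i j)
      (fun h => (h *: 0) *: diag_delta i j).
    have dp := is_derive1_is_diff dsin2.
    exact: (is_diff_comp dp (is_diff_scalel _ _)).
  have d2 : is_diff (0 : R) (fun t => (k *: (@sin R * @cos R)) t *: sym_delta i j)
      (fun h => (h *: k) *: sym_delta i j).
    have dp := is_derive1_is_diff (dsincos k).
    exact: (is_diff_comp dp (is_diff_scalel _ _)).
  have dA := is_diff_cst A (0 : R).
  apply: (is_diff_eq (is_diffD (is_diffD dA d1) d2)).
  by apply/funext => h; rewrite !fctE /= scaler0 scale0r !add0r scalerA.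
have M0 : M 0 = A.
  by rewrite /M /= !fctE /= sin0 mul0r mul0r !scaler0 !scale0r !addr0.
have entry_linear : linear (fun X : symmat R n => X i j).
  by move=> c X Y; rewrite symmatDE symmatZE.
pose mE := GRing.isLinear.Build _ _ _ _ _ entry_linear.
pose E : {linear symmat R n -> R} := HB.pack (fun X : symmat R n => X i j) mE.
(* By equivariance this is the [(i, j)] entry of the rotated [G A]; since [G A i j = 0], only the
   gap [l] of diagonal entries contributes. *)
have EGM : E \o (G \o M) = l *: (@sin R * @cos R).
  apply/funext => t /=; rewrite /M !fctE.
  rewrite -/(k * (sin t * sin t)) -/(k * (sin t * cos t)) -expr2.
  rewrite -(sconj_rotmx_diag a ij (cos2Dsin2 t)) GU.
    by rewrite sconj_rotmxE// Gij mulr0 add0r mulrC.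
  by apply: rotmx_ortho => //; exact: cos2Dsin2.
have dEGM : is_diff (0 : R) (E \o (G \o M)) 
    (E \o ('d G A \o (fun h => h *: (k *: sym_delta i j)))).
  have := is_diff_symmat E (G (M 0)) => ?.
  apply: is_diff_comp; apply: is_diff_comp.
  by rewrite M0; exact: differentiableP.
rewrite EGM in dEGM.
have := congr1 (@^~ 1) (is_diff_unique dEGM (is_derive1_is_diff (dsincos l))).
by rewrite /= !scale1r linearZ symmatZE.
Qed.

(** * The Hessian formula at a diagonal matrix *)

Theorem theorem5p4 (R : realType) (n : nat) (f : 'rV[R]_n -> R)
    (f_sym : symmetric_fun f) (a : 'rV[R]_n)
    (F_C2 : C2_around (@trace_ip R n) (f \o @eigvals R n) (sym_diag a))
    (B : symmat R n) :
  let Z : symmat R n :=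
    hessian (@trace_ip R n) (f \o @eigvals R n) (sym_diag a) B in
  let g : 'rV[R]_n := gradient (@dot_ip R n) f a in
  let H : 'M[R]_n := hessian_mx f a in
  [/\ twice_differentiable (@dot_ip R n) f a,
      mxdiag_vec Z = hessian (@dot_ip R n) f a (mxdiag_vec B) &
      forall i j : 'I_n, i != j ->
        (a 0 i <> a 0 j ->
           Z i j = B i j * ((g 0 i - g 0 j) / (a 0 i - a 0 j))) /\
        (a 0 i = a 0 j -> Z i j = B i j * (H i i - H i j))].
Proof.
rewrite /hessian_mx /jacobian /hessian; set F := f \o _; set G := gradient _ F.
have [[dF dG] _] := nbhs_singleton F_C2.
have [df d2f] := is_diff_gradient_spectral_diag f_sym dF dG.
have ZU U X (UU : is_orthomx U) (UA : sconj U (sym_diag a) = sym_diag a) :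
    'd G (sym_diag a) (sconj U X) = sconj U ('d G (sym_diag a) X).
  exact: hessian_sconj.
have dFA : differentiable F (sym_diag a) := nbhs_singleton dF.
have GU U (UU : is_orthomx U) :
    G (sconj U (sym_diag a)) = sconj U (G (sym_diag a)).
  exact: gradient_sconj.
have g_diag : gradient (@dot_ip R n) f a = mxdiag_vec (G (sym_diag a)).
  exact: gradient_spectral_diag.
split=> [|| i j ij]; first by split=> //; exact: ex_diff.
  rewrite diff_val; apply/rowP => i; rewrite [LHS]mxE [RHS]mxE.
  exact: (equivariant_diag_entry ZU).
rewrite (equivariant_offdiag_entry ZU)//; split=> aij; congr (_ * _).
  (* Flipping coordinate [i] fixes [Diag a] but negates this entry of the gradient, so the entry
     equals its own opposite. *)
  have Gij : G (sym_diag a) i j = 0.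
    have := congr1 (fun X : symmat R n => X i j) (GU _ (signmx_ortho i)).
    rewrite sconj_signmx_diag sconj_signmxE eqxx eq_sym (negPf ij) expr1.
    by lra.
  have := diff_rotation_equivariant ij dG Gij GU.
  have aji : a 0 i - a 0 j != 0 by rewrite subr_eq0; exact/eqP.
  rewrite g_diag !mxE => rot; apply: (canRL (mulfK aji)).
  by rewrite -[RHS]opprB -rot; ring.
(* Row [i] of the Jacobian is the differential of the gradient of [f] at the [i]-th basis vector,
   that is, the diagonal of the image of [sym_diag (delta_mx 0 i)]. *)
rewrite (equivariant_sym_delta ZU)// !mxE diff_val /=.
by rewrite !mxE.
Qed.
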